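(* Let $\mathcal{G}$ be a Fréchet $\widetilde{\mathbb{C}}$-module and let $\mathcal{F}$ be a locally convex topological $\widetilde{\mathbb{C}}$-module which has an absolutely convex web of type $\mathcal{C}$. If a $\widetilde{\mathbb{C}}$-linear map $T:\mathcal{G}\to\mathcal{F}$ has sequentially closed graph (in $\mathcal{G}\times\mathcal{F}$ with the product topology), then $T$ is continuous.
   Context: Generalized numbers: $\widetilde{\mathbb{C}}=\mathcal{E}_M/\mathcal{N}$, where $\mathcal{E}_M$ is the ring of nets $(c_\varepsilon)_\varepsilon\in\mathbb{C}^{(0,1]}$ with $|c_\varepsilon|=O(\varepsilon^{-N})$ as $\varepsilon\to0$ for some $N\in\mathbb{N}$, and $\mathcal{N}$ is the ideal of nets with $|c_\varepsilon|=O(\varepsilon^{q})$ for all $q\in\mathbb{N}$; $[(c_\varepsilon)_\varepsilon]$ denotes the class of $(c_\varepsilon)_\varepsilon$. The valuation is $\mathrm{v}(c)=\sup\{b\in\mathbb{R}: |c_\varepsilon|=O(\varepsilon^b)\text{ as }\varepsilon\to0\}$ and $|c|_{\mathrm e}=e^{-\mathrm{v}(c)}$; $\widetilde{\mathbb{C}}$ carries the topology of the ultrametric $|c-d|_{\mathrm e}$. A topological $\widetilde{\mathbb{C}}$-module is a $\widetilde{\mathbb{C}}$-module with a topology making addition and scalar multiplication $\widetilde{\mathbb{C}}\times\mathcal{G}\to\mathcal{G}$ continuous. A subset $A$ of a $\widetilde{\mathbb{C}}$-module is balanced if $\lambda A\subseteq A$ whenever $|\lambda|_{\mathrm e}\le1$;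 convex if $A+A\subseteq A$ and $[(\varepsilon^b)_\varepsilon]A\subseteq A$ for all $b\ge0$; absolutely convex if balanced and convex. A topological $\widetilde{\mathbb{C}}$-module is locally convex if it has a base of convex neighborhoods of $0$. A Fréchet $\widetilde{\mathbb{C}}$-module is a complete metrizable locally convex topological $\widetilde{\mathbb{C}}$-module. A web on a locally convex topological $\widetilde{\mathbb{C}}$-module $\mathcal{F}$ is a family $\mathcal{W}=\{C(n_1,\dots,n_k)\}$ of subsets of $\mathcal{F}$, with $k,n_1,\dots,n_k$ running through $\mathbb{N}\setminus0$, such that $\mathcal{F}=\bigcup_{n_1\ge1}C(n_1)$ and $C(n_1,\dots,n_{k-1})=\bigcup_{n_k\ge1}C(n_1,\dots,n_k)$ for all $k>1$ and all $n_1,\dots,n_{k-1}$. The web is absolutely convex if all its sets are. It is of type $\mathcal{C}$ if for every sequence $(n_k)_{k\ge1}$ in $\mathbb{N}\setminus0$ there is a sequence $(\rho_k)_{k\ge1}$ in $\mathbb{R}$ such that for all $\lambda_k\ge\rho_k$ and all $x_k\in C(n_1,\dots,n_k)$ ($k\ge1$) the series $\sum_{k=1}^\infty[(\varepsilon^{\lambda_k})_\varepsilon]x_k$ converges in $\mathcal{F}$. *)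

(* Defs.v *)
From HB Require Import structures.
From mathcomp Require Import all_boot all_order all_algebra.
From mathcomp Require Import ring_quotient generic_quotient.
From mathcomp Require Import all_classical all_reals all_analysis.
From mathcomp.real_closed Require Import complex.

Set Implicit Arguments.
Unset Strict Implicit.
Unset Printing Implicit Defensive.

Import Order.TTheory GRing.Theory Num.Theory.
Import ComplexField.Normc.

Local Open Scope classical_set_scope.
Local Open Scope complex_scope.
Local Open Scope ring_scope.
Local Open Scope quotient_scope.

(* The index set (0,1]. It is made pointed because the library puts a        *)
(* (nontrivial) ring structure on functions only when their domain is.        *)
Record eps_index (R : realType) := EpsIndex {
  eps_val :> R;
  eps_valP : 0 < eps_val <= 1 }.

HB.instance Definition _ (R : realType) := [isSub for @eps_val R].
HB.instance Definition _ (R : realType) := [Choice of eps_index R by <:].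

Lemma eps_index1_subproof (R : realType) : 0 < (1 : R) <= 1.
Proof. by rewrite ltr01 lexx. Qed.

HB.instance Definition _ (R : realType) :=
  isPointed.Build (eps_index R) (EpsIndex (eps_index1_subproof R)).

Notation net R := (eps_index R -> R[i]).

Definition bigO_pow (R : realType) (c : net R) (b : R) : Prop :=
  exists M eta : R, 0 < eta /\
    forall e : eps_index R, e <= eta :> R -> normc (c e) <= M * (e : R) `^ b.

Section BigOPow.
Context {R : realType}.
Implicit Types (c d : net R) (a b : R).

Lemma bigO_powP c b : bigO_pow c b -> exists M eta : R, [/\ 0 <= M, 0 < eta &
  forall e : eps_index R, e <= eta :> R -> normc (c e) <= M * (e : R) `^ b].
Proof.
move=> [M [eta [eta0 H]]]; exists `|M|, eta; split => // e /H /le_trans; apply.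
by rewrite ler_wpM2r ?powR_ge0// ler_norm.
Qed.

Lemma bigO_pow_le c a b : a <= b -> bigO_pow c b -> bigO_pow c a.
Proof.
move=> ab /bigO_powP[M [eta [M0 eta0 H]]]; exists M, eta; split => // e /H.
move=> /le_trans; apply; rewrite ler_wpM2l//.
have /andP[e0 e1] := eps_valP e.
by rewrite ger_powR// e0.
Qed.

Lemma bigO_powD c d b : bigO_pow c b -> bigO_pow d b -> bigO_pow (c + d) b.
Proof.
move=> [M [u [u0 H]]] [N [v [v0 K]]]; exists (M + N), (Num.min u v).
split => [|e]; first by rewrite lt_min u0.
rewrite le_min => /andP[/H cM /K dN].
by rewrite (le_trans (le_normcD _ _))// mulrDl lerD.
Qed.

Lemma bigO_powN c b : bigO_pow c b -> bigO_pow (- c) b.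
Proof.
by move=> [M [u [u0 H]]]; exists M, u; split => // e /H; rewrite normcN.
Qed.

Lemma bigO_powM c d a b :
  bigO_pow c a -> bigO_pow d b -> bigO_pow (c * d) (a + b).
Proof.
move=> /bigO_powP[M [u [M0 u0 H]]] /bigO_powP[N [v [N0 v0 K]]].
exists (M * N), (Num.min u v); split => [|e]; first by rewrite lt_min u0.
rewrite le_min => /andP[/H cM /K dN].
have /andP[e0 _] := eps_valP e.
rewrite normcM powRD; last by apply/implyP => _; rewrite gt_eqF.
have nc0 (z : R[i]) : 0 <= normc z by case: z => x y /=; rewrite sqrtr_ge0.
by rewrite mulrACA ler_pM.
Qed.

Lemma bigO_pow0 b : bigO_pow (0 : net R) b.
Proof. by exists 0, 1; split => // e _; rewrite normc0 mul0r. Qed.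

Lemma bigO_pow1 : bigO_pow (1 : net R) 0.
Proof. by exists 1, 1; split => // e _; rewrite normc1 powRr0 mulr1. Qed.

Lemma bigO_powr b : bigO_pow (fun e : eps_index R => ((e : R) `^ b)%:C) b.
Proof.
exists 1, 1; split => // e _ /=.
by rewrite expr0n/= addr0 sqrtr_sqr ger0_norm ?powR_ge0// mul1r.
Qed.

End BigOPow.

Definition moderate (R : realType) : pred (net R) :=
  fun c => `[< exists N : nat, bigO_pow c (- N%:R) >].

Lemma moderate_subring_closed (R : realType) : subring_closed (@moderate R).
Proof.
split.
- by apply/asboolP; exists 0%N; rewrite oppr0; exact: bigO_pow1.
- move=> c d /asboolP[M cM] /asboolP[N dN]; apply/asboolP; exists (M + N)%N.
  apply: bigO_powD; [apply: bigO_pow_le cM|apply/bigO_powN/(bigO_pow_le _ dN)];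
    by rewrite lerN2 ler_nat ?leq_addr ?leq_addl.
- move=> c d /asboolP[M cM] /asboolP[N dN]; apply/asboolP; exists (M + N)%N.
  by rewrite natrD opprD; exact: bigO_powM.
Qed.

HB.instance Definition _ (R : realType) :=
  GRing.isSubringClosed.Build (net R) (@moderate R)
    (@moderate_subring_closed R).

Record moderate_net (R : realType) := ModerateNet {
  mnet_val :> net R;
  mnet_valP : mnet_val \in @moderate R }.

HB.instance Definition _ (R : realType) := [isSub for @mnet_val R].
HB.instance Definition _ (R : realType) := [Choice of moderate_net R by <:].
HB.instance Definition _ (R : realType) :=
  [SubChoice_isSubComNzRing of moderate_net R by <:].

Definition negligible (R : realType) : pred (moderate_net R) :=
  fun c => `[< forall q : nat, bigO_pow c q%:R >].

Lemma bigO_pow_negligible (R : realType) (c : moderate_net R) (b : R) :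
  c \in @negligible R -> bigO_pow c b.
Proof.
move=> /asboolP H; apply: bigO_pow_le (H (Num.bound `|b|)).
by rewrite (le_trans (ler_norm b))// ltW// archi_boundP.
Qed.

Lemma negligible_idealr_closed (R : realType) : idealr_closed (@negligible R).
Proof.
split.
- by apply/asboolP => q; exact: bigO_pow0.
- apply/negP => /asboolP /(_ 1%N) /bigO_powP[M [eta [M0 eta0 H]]].
  pose t := Num.min eta (Num.min 1 (M + 1)^-1 / 2).
  have M1 : 0 < M + 1 by rewrite ltr_wpDl.
  have m0 : 0 < Num.min 1 (M + 1)^-1 by rewrite lt_min ltr01 invr_gt0.
  have t01 : 0 < t <= 1.
    rewrite lt_min eta0 divr_gt0//= ge_min orbC ler_pdivrMr// mul1r.
    by rewrite ge_min ler1n.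
  have := H (EpsIndex t01); rewrite /= ge_min lexx => /(_ isT).
  rewrite expr1n expr0n/= addr0 sqrtr1 powRr1; last by case/andP: t01 => /ltW.
  apply/negP; rewrite -ltNge.
  have tM : t < (M + 1)^-1.
    rewrite gt_min; apply/orP; right; rewrite ltr_pdivrMr//.
    rewrite gt_min; apply/orP; right.
    by rewrite ltr_pMr ?invr_gt0// ltr1n.
  rewrite (@le_lt_trans _ _ ((M + 1) * t))//.
    by rewrite ler_wpM2r ?lerDl//; case/andP: t01 => /ltW.
  by rewrite -ltr_pdivlMl// mulr1.
- move=> a u v /asboolP uN /asboolP vN; apply/asboolP => q.
  apply: bigO_powD; last exact: vN.
  have /asboolP[N aN] := mnet_valP a.
  have := bigO_powM aN (uN (N + q)%N).
  by rewrite natrD addrA addNr add0r.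
Qed.

HB.instance Definition _ (R : realType) :=
  isIdealr.Build (moderate_net R) (@negligible R)
    (@negligible_idealr_closed R).

Definition negligible_ideal (R : realType) : idealr (moderate_net R) :=
  @negligible R.

Definition gen_num (R : realType) := {ideal_quot negligible_ideal R}.

HB.instance Definition _ (R : realType) := GRing.ComNzRing.on (gen_num R).

Definition gclass (R : realType) (c : moderate_net R) : gen_num R :=
  \pi_{ideal_quot negligible_ideal R} c.

Definition net_valuation (R : realType) (c : net R) : \bar R :=
  ereal_sup [set b%:E | b in [set b : R | bigO_pow c b]].

(* Computed on the canonical representative; gvaluation_class shows that any *)
(* representative may be used.                                               *)
Definition gvaluation (R : realType) (x : gen_num R) : \bar R :=
  net_valuation (repr (x : {ideal_quot negligible_ideal R})).

(* |x|_e = exp(-v(x)), with exp(-oo) = 0 *)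
Definition gabs (R : realType) (x : gen_num R) : R :=
  fine (expeR (- gvaluation x)%E).

Section Valuation.
Context {R : realType}.
Implicit Types (c d : moderate_net R) (x y : gen_num R).

Lemma gclassP c d : gclass c = gclass d <-> (c - d) \in @negligible R.
Proof.
rewrite (Quotient.idealrBE (negligible_ideal R)).
by split => [?|/eqP //]; apply/eqP.
Qed.

Lemma gclassD c d : gclass (c + d) = gclass c + gclass d.
Proof. exact: rmorphD. Qed.

Lemma gclassN c : gclass (- c) = - gclass c.
Proof. exact: rmorphN. Qed.

Lemma gclassK x : gclass (repr (x : {ideal_quot negligible_ideal R})) = x.
Proof. exact: reprK. Qed.

Lemma gvaluation_class c : gvaluation (gclass c) = net_valuation c.
Proof.
have sub c1 c2 b : gclass c1 = gclass c2 -> bigO_pow c1 b -> bigO_pow c2 b.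
  move=> /esym/gclassP/(bigO_pow_negligible b) + cb.
  by move=> /bigO_powD /(_ cb); rewrite /= subrK.
rewrite /gvaluation /net_valuation; congr (ereal_sup (_ @` _)).
by apply/seteqP; split => b /=; apply: sub; rewrite gclassK.
Qed.

Lemma bigO_pow_lt_valuation (c : net R) (b : R) :
  (b%:E < net_valuation c)%E -> bigO_pow c b.
Proof.
move=> /ereal_sup_gt[_ [a /= ca <-]]; rewrite lte_fin => /ltW ba.
exact: bigO_pow_le ca.
Qed.

Lemma net_valuation_ge (c : net R) (b : R) :
  bigO_pow c b -> (b%:E <= net_valuation c)%E.
Proof. by move=> cb; apply: ereal_sup_ubound; exists b. Qed.

Lemma gvaluation_gtNy x : (-oo < gvaluation x)%E.
Proof.
rewrite -(gclassK x) gvaluation_class; set c := repr _.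
have /asboolP[N cN] := mnet_valP c.
exact: lt_le_trans (ltNyr _) (net_valuation_ge cN).
Qed.

Lemma gvaluationD x y :
  (Order.min (gvaluation x) (gvaluation y) <= gvaluation (x + y)%R)%E.
Proof.
rewrite -(gclassK x) -(gclassK y) -gclassD !gvaluation_class.
set c := repr _; set d := repr _.
rewrite leNgt; apply/negP => H.
have [b cdb] : exists b : R, (net_valuation (c + d)%R < b%:E <
    Order.min (net_valuation c) (net_valuation d))%E.
  have cd : (net_valuation (c + d)%R > -oo)%E.
    by rewrite -gvaluation_class; exact: gvaluation_gtNy.
  move: H cd; set m := Order.min _ _.
  case: net_valuation => [r| |] //; case: m => [s| |] //.
  - rewrite lte_fin => rs _; exists ((r + s) / 2); rewrite !lte_fin.
    by rewrite midf_lt ?midf_lt.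
  - by move=> _ _; exists (r + 1); rewrite lte_fin ltrDl ltr01 ltry.
move: cdb; rewrite lt_min => /and3P[+ /bigO_pow_lt_valuation cb
  /bigO_pow_lt_valuation db].
by apply/negP; rewrite -leNgt; exact/net_valuation_ge/bigO_powD.
Qed.

Lemma gvaluationN x : gvaluation (- x) = gvaluation x.
Proof.
rewrite -(gclassK x) -gclassN !gvaluation_class; set c := repr _.
rewrite /net_valuation; congr (ereal_sup (_ @` _)).
apply/seteqP; split => b /= /bigO_powN //.
by rewrite /= opprK.
Qed.

Lemma gvaluation_eqy x : gvaluation x = +oo%E -> x = 0.
Proof.
rewrite -(gclassK x) gvaluation_class; set c := repr _ => cy.
rewrite -[RHS](rmorph0 (\pi_{ideal_quot negligible_ideal R})); apply/gclassP.
rewrite subr0; apply/asboolP => q.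
by apply: bigO_pow_lt_valuation; rewrite cy ltry.
Qed.

Lemma gvaluation0 : gvaluation (0 : gen_num R) = +oo%E.
Proof.
rewrite -[X in gvaluation X](rmorph0 (\pi_{ideal_quot negligible_ideal R})).
rewrite -/(gclass _) gvaluation_class; apply/eqyP => A _.
by apply: net_valuation_ge; exact: bigO_pow0.
Qed.

Lemma gabsE x : (gabs x)%:E = expeR (- gvaluation x)%E.
Proof.
rewrite /gabs fineK// fin_numE expeR_eqy gt_eqF ?(lt_le_trans _ (expeR_ge0 _))//=.
by have := gvaluation_gtNy x; case: gvaluation.
Qed.

Lemma gabs_ge0 x : 0 <= gabs x.
Proof. by rewrite -lee_fin gabsE expeR_ge0. Qed.

Lemma gabs0 : gabs (0 : gen_num R) = 0.
Proof. by rewrite /gabs gvaluation0. Qed.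

Lemma gabs_eq0 x : gabs x = 0 -> x = 0.
Proof.
move=> x0; apply: gvaluation_eqy; apply: oppe_inj; apply/eqP.
by rewrite -expeR_eq0 -gabsE x0.
Qed.

Lemma gabsN x : gabs (- x) = gabs x.
Proof. by rewrite /gabs gvaluationN. Qed.

Lemma gabsD_max x y : gabs (x + y) <= Num.max (gabs x) (gabs y).
Proof.
have := gvaluationD x y; rewrite le_max -!lee_fin !gabsE !lee_expeR !leeN2.
by rewrite ge_min.
Qed.

Lemma gabsD x y : gabs (x + y) <= gabs x + gabs y.
Proof.
by rewrite (le_trans (gabsD_max x y))// ge_max lerDl lerDr !gabs_ge0.
Qed.

End Valuation.

Section Topology.
Context (R : realType).

Definition gdist (x y : gen_num R) : R := gabs (x - y).

Lemma gdistxx x : gdist x x = 0.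
Proof. by rewrite /gdist subrr gabs0. Qed.

Lemma gdist_positivity x y : gdist x y = 0 -> x = y.
Proof. by move=> /gabs_eq0/eqP; rewrite subr_eq0 => /eqP. Qed.

Lemma gdist_sym x y : gdist x y = gdist y x.
Proof. by rewrite /gdist -gabsN opprB. Qed.

Lemma gdist_triangle y x z : gdist x z <= gdist x y + gdist y z.
Proof. by rewrite /gdist -[x - z](subrKA y) gabsD. Qed.

HB.instance Definition _ := isMetric.Build R (gen_num R)
  gdistxx gdist_positivity gdist_sym gdist_triangle.

End Topology.

Lemma powr_net_moderate (R : realType) (b : R) :
  (fun e : eps_index R => ((e : R) `^ b)%:C) \in @moderate R.
Proof.
apply/asboolP; exists (Num.bound `|b|); apply: bigO_pow_le (bigO_powr b).
by rewrite lerNl (le_trans (ler_norm _))// normrN ltW// archi_boundP.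
Qed.

Definition gpow (R : realType) (b : R) : gen_num R :=
  gclass (ModerateNet (powr_net_moderate b)).

(* The scaling is a field of the mixin, because HB cannot join Topological    *)
(* and Lmodule over a ring which is not a numDomainType; the Lmodule          *)
(* structure is recovered just below.                                         *)
HB.mixin Record isTopologicalGModule (R : realType) M
    & TopologicalZmodule M := {
  gscale : gen_num R -> M -> M ;
  gscaleA : forall a b v, gscale a (gscale b v) = gscale (a * b) v ;
  gscale1 : left_id 1 gscale ;
  gscaleDr : right_distributive gscale +%R ;
  gscaleDl : forall v, {morph gscale^~ v : a b / a + b} ;
  gscale_continuous : continuous (fun z : gen_num R * M => gscale z.1 z.2)
}.

(* TopologicalZmodule says that addition and opposite are continuous; the     *)
(* latter is redundant, opposite being the scaling by -1.                     *)
#[short(type="topologicalGModType")]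
HB.structure Definition TopologicalGModule (R : realType) :=
  {M of TopologicalZmodule M & isTopologicalGModule R M}.

HB.instance Definition _ (R : realType) (M : topologicalGModType R) :=
  GRing.Zmodule_isLmodule.Build (gen_num R) (TopologicalGModule.sort M)
    gscaleA gscale1 gscaleDr gscaleDl.

Lemma gmod_scale_continuous (R : realType) (M : topologicalGModType R) :
  continuous (fun z : gen_num R * M => z.1 *: z.2).
Proof. exact: gscale_continuous. Qed.

Section GModule.
Context (R : realType).

Definition balanced (M : lmodType (gen_num R)) (A : set M) : Prop :=
  forall (l : gen_num R) x, gabs l <= 1 -> A x -> A (l *: x).

(* This is not convexity in the real sense. *)
Definition gconvex (M : lmodType (gen_num R)) (A : set M) : Prop :=
  (forall x y, A x -> A y -> A (x + y)) /\
  (forall (b : R) x, 0 <= b -> A x -> A (gpow b *: x)).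

Definition absolutely_gconvex (M : lmodType (gen_num R)) (A : set M) : Prop :=
  balanced A /\ gconvex A.

Definition locally_gconvex (M : topologicalGModType R) : Prop :=
  forall U : set M, nbhs 0 U -> exists V : set M,
    [/\ nbhs 0 V, gconvex V & V `<=` U].

Definition metrizable (T : topologicalType) : Prop :=
  exists d : T -> T -> R,
    [/\ forall x y, d x y = 0 <-> x = y,
        forall x y, d x y = d y x,
        forall x y z, d x z <= d x y + d y z &
        forall x (A : set T),
          nbhs x A <-> exists2 r : R, 0 < r & [set y | d x y < r] `<=` A].

(* completeness for the uniform structure of the additive topological group: *)
(* a filter F is Cauchy when x - y tends to 0 along F * F                    *)
Definition group_complete (M : topologicalGModType R) : Prop :=
  forall F : set_system M, ProperFilter F ->
    (fun z : M * M => z.1 - z.2) @ (F, F) --> (0 : M) ->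
    exists x : M, F --> x.

Definition frechet (M : topologicalGModType R) : Prop :=
  [/\ group_complete M, metrizable M & locally_gconvex M].

(* The index (n_1, ..., n_k) is the list [:: n_1; ...; n_k]. *)
Definition web_index (s : seq nat) : bool :=
  (s != [::]) && all (fun n => 0 < n)%N s.

Definition web (M : Type) (C : seq nat -> set M) : Prop :=
  setT = \bigcup_(n in [set n | (0 < n)%N]) C [:: n] /\
  forall s, web_index s ->
    C s = \bigcup_(n in [set n | (0 < n)%N]) C (rcons s n).

Definition absolutely_gconvex_web (M : lmodType (gen_num R))
    (C : seq nat -> set M) : Prop :=
  forall s, web_index s -> absolutely_gconvex (C s).

(* Sequences (n_k), (rho_k), (lambda_k), (x_k) are indexed from 1: their     *)
(* value at 0 is irrelevant.                                                 *)
Definition web_typeC (M : topologicalGModType R)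
    (C : seq nat -> set M) : Prop :=
  forall n : nat -> nat, (forall k, (0 < k)%N -> (0 < n k)%N) ->
  exists rho : nat -> R, forall (lambda : nat -> R) (x : nat -> M),
    (forall k, (0 < k)%N -> rho k <= lambda k) ->
    (forall k, (0 < k)%N -> C [seq n i | i <- iota 1 k] (x k)) ->
    exists l : M,
      (fun m => \sum_(1 <= k < m.+1) gpow (lambda k) *: x k) @ \oo --> l.

End GModule.

Definition sequentially_closed (T : topologicalType) (A : set T) : Prop :=
  forall (u : nat -> T) (x : T), (forall n, A (u n)) -> u @ \oo --> x -> A x.

Definition graph_set (T U : Type) (f : T -> U) : set (T * U) :=
  [set z | z.2 = f z.1].

(* Main.v *)
Require Import Defs.
From mathcomp Require Import all_boot all_order all_algebra.
From mathcomp Require Import all_classical all_reals all_analysis.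
From mathcomp.real_closed Require Import complex.

Import Order.TTheory GRing.Theory Num.Theory.

(** De Wilde's closed graph argument, in which convexity only ever enters
    through additive subgroups.

    A convex neighborhood of 0 intersected with its opposite is an open
    subgroup, so neighborhoods of 0 may be taken to be open subgroups, which
    are also closed. A nonempty absolutely convex set, such as a set of the
    web, is a subgroup as well.

    The Frechet module [G] is not meager in itself ([frechet_not_meager]), so
    one can descend along a branch [n] of the web so that every preimage [D k]
    under [T] of the [k]-th set [Ck k] of the branch is not meager
    ([nonmeager_web_branch]). The closure of the subgroup [D k] then has an
    interior point, hence is a neighborhood of 0 ([closure_subgroup_nbhs0]),
    and multiplying by the invertible scalar [gpow (rho k)] preserves this
    ([nbhs0_closure_gpow]).

    Type C provides exponents [rho k] such that series with terms in
    [gpow (rho k) *: Ck k] converge. The terms of a convergent series tend to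
    0, and the choice of the terms is free, so the sets [gpow (rho k) *: Ck k]
    themselves shrink to 0: a given open subgroup [H] of [F] contains all of
    them from some index [N] on ([web_typeC_small]).

    A point [x] of the closure of the [N]-th scaled preimage is the sum of a
    series with terms in the scaled preimages of index at least [N]
    ([closure_series_expansion]): the error left after each step is small
    enough to be approximated in the next one. The images of the partial sums
    lie in [H] and converge, by type C; as the graph is sequentially closed,
    their limit is [T x], which lies in [H] because [H] is closed. So
    [T @^-1` H] contains the closure of a scaled preimage, a neighborhood of
    0. *)

Set Implicit Arguments.
Unset Strict Implicit.
Unset Printing Implicit Defensive.

Local Open Scope classical_set_scope.
Local Open Scope ring_scope.

(** * Subgroups of topological abelian groups *)

Definition additive_subgroup {G : zmodType} (H : set G) : Prop :=
  H 0 /\ forall x y, H x -> H y -> H (x - y).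

Lemma additive_subgroupN (G : zmodType) (H : set G) x :
  additive_subgroup H -> H x -> H (- x).
Proof. by move=> [H0 HB] Hx; rewrite -[- x]add0r; exact: HB. Qed.

Lemma additive_subgroupD (G : zmodType) (H : set G) x y :
  additive_subgroup H -> H x -> H y -> H (x + y).
Proof.
move=> sH Hx Hy; rewrite -[y]opprK; apply: sH.2 => //.
exact: additive_subgroupN.
Qed.

Lemma additive_subgroup_sum (G : zmodType) (H : set G) (u : nat -> G) a b :
  additive_subgroup H -> (forall k, H (u k)) -> H (\sum_(a <= k < b) u k).
Proof.
move=> sH Hu; elim/big_ind : _ => // [|x y]; first exact: sH.1.
exact: additive_subgroupD.
Qed.

Section TopologicalGroup.
Context (G : topologicalZmodType).
Implicit Types (A D H : set G) (x y z : G).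

Lemma addl_continuous x : continuous (+%R x : G -> G).
Proof.
move=> z; have := @add_continuous G (x, z).
exact: (cvg_comp2 (cvg_cst x) cvg_id).
Qed.

Lemma nbhs_translate0 x A : nbhs x A -> nbhs 0 [set z | A (x + z)].
Proof.
by have := @addl_continuous x 0; rewrite /continuous_at addr0 => /[apply].
Qed.

Lemma nbhs_translate x A : nbhs 0 A -> nbhs x [set y | A (y - x)].
Proof.
move=> A0; have := @addl_continuous (- x) x; rewrite /continuous_at addNr.
have -> : [set y | A (y - x)] = +%R (- x) @^-1` A.
  by apply/funext => y /=; rewrite addrC.
by move/(_ A A0).
Qed.

Lemma nbhs_reflect x A : nbhs 0 A -> nbhs x [set y | A (x - y)].
Proof.
move=> A0; have: nbhs 0 [set z | A (- z)].
  by have := @opp_continuous G 0; rewrite /continuous_at oppr0 => /(_ A A0).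
move=> /(nbhs_translate x); apply: filterS => y /=.
by rewrite opprB.
Qed.

Lemma cvgB_group (I : Type) (L : set_system I) (FL : Filter L)
    (f g : I -> G) x y :
  f @ L --> x -> g @ L --> y -> (fun i => f i - g i) @ L --> x - y.
Proof.
move=> fx gy.
exact: (cvg_comp2 (h := fun a b : G => a - b) fx gy (@sub_continuous G (x, y))).
Qed.

Lemma closure_additive_subgroup D :
  additive_subgroup D -> additive_subgroup (closure D).
Proof.
move=> sD; split; first exact/subset_closure/sD.1.
move=> x y Dx Dy W /(@sub_continuous G (x, y))[[P Q] /= [xP yQ] PQW].
have [a [Da Pa]] := Dx _ xP; have [b [Db Qb]] := Dy _ yQ.
exists (a - b); split; first exact: sD.2.
exact: (PQW (a, b)).
Qed.

(** Translate an interior point [x] of the closure to 0: the difference of two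
    points of the closure stays in it. *)
Lemma closure_subgroup_nbhs0 D : additive_subgroup D ->
  (closure D)^° !=set0 -> nbhs 0 (closure D).
Proof.
move=> /closure_additive_subgroup sD [x xD].
have Dx : closure D x by exact: nbhs_singleton.
apply: filterS (nbhs_translate0 xD) => z /= Dxz.
by have -> : z = x + z - x by [rewrite addrAC subrr add0r]; exact: sD.2.
Qed.

(** The limit differs from a late term of the sequence by an element of [H]. *)
Lemma open_subgroup_closed H (u : nat -> G) x : additive_subgroup H ->
  nbhs 0 H -> (\forall n \near \oo, H (u n)) -> u @ \oo --> x -> H x.
Proof.
move=> sH H0 Hu ux.
have : \forall n \near \oo, H (x - u n) by exact: (ux _ (nbhs_reflect x H0)).
move=> /filterI /(_ Hu) /filter_ex[n [Hxu Hun]].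
by rewrite -[x](subrK (u n)); exact: additive_subgroupD.
Qed.

End TopologicalGroup.

(** * Baire category in Frechet modules *)

Lemma metrizable_nbhs_base {R : realType} {T : topologicalType} (x : T) :
  metrizable R T -> exists V : nat -> set T, (forall n, nbhs x (V n)) /\
    forall A, nbhs x A -> \forall n \near \oo, V n `<=` A.
Proof.
move=> [d [_ _ _ nbhsd]]; exists (fun n => [set y | d x y < n.+1%:R^-1]).
split=> [n|A /nbhsd[r r0 rA]].
  by apply/nbhsd; exists n.+1%:R^-1 => //; rewrite invr_gt0.
have : \forall n \near \oo, n.+1%:R^-1 < r.
  by exact: near_infty_natSinv_lt (PosNum r0).
by apply: filterS => n nr y /= /lt_trans; move/(_ _ nr); exact: rA.
Qed.

Definition meager {T : topologicalType} (A : set T) : Prop :=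
  exists B : nat -> set T,
    (forall n, (closure (B n))^° = set0) /\ A `<=` \bigcup_n B n.

Lemma not_meager_interior_closure {T : topologicalType} (A : set T) :
  ~ meager A -> (closure A)^° !=set0.
Proof.
move=> mA; apply/set0P/eqP => A0; apply: mA; exists (fun=> A).
by split=> // x Ax; exists 0%N.
Qed.

Lemma meager_bigcup {T : topologicalType} (A : nat -> set T) :
  (forall n, meager (A n)) -> meager (\bigcup_n A n).
Proof.
move=> /choice[B HB].
exists (fun k => if unpickle k is Some ij then B ij.1 ij.2 else set0).
split=> [k|x [i _ /(proj2 (HB i))[j _ Bx]]].
  case: unpickle => [[i j]|]; first exact: (HB i).1.
  by rewrite closure0 interior0.
by exists (pickle (i, j)) => //; rewrite pickleK.
Qed.

Section LocallyConvex.
Context {R : realType} {G : topologicalGModType R}.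

(** A convex set is stable under addition, and intersecting it with its opposite
    makes it stable under negation as well. *)
Lemma gconvex_open_subgroup (U : set G) : locally_gconvex G -> nbhs 0 U ->
  exists H : set G, [/\ additive_subgroup H, nbhs 0 H & H `<=` U].
Proof.
move=> cG /cG[V [V0 [VD _] VU]]; exists [set x | V x /\ V (- x)]; split.
- split=> [|x y [Vx Vx'] [Vy Vy']].
    by rewrite /= oppr0; split; exact: nbhs_singleton.
  by split=> /=; rewrite ?opprB ?[y - x]addrC; exact: VD.
- apply: filterI => //.
  have := nbhs_reflect 0 V0; congr (nbhs _ _).
  by apply/funext => y /=; rewrite sub0r.
- by move=> x [/VU].
Qed.

(** Baire's theorem, with cosets of open subgroups in the role of closed balls.
    Given nowhere dense sets [B n], cosets [x n + H n] are nested so that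
    [x n.+1 + H n.+1] avoids [B n] and [H n.+1] is contained in [V n]. The
    centers form a Cauchy sequence, and its limit lies in every coset because
    open subgroups are closed. *)
Theorem frechet_not_meager : frechet G -> ~ meager [set: G].
Proof.
move=> [cpl /(metrizable_nbhs_base 0)[V [V0 Vbase]] cvx] [B [Bint Bcover]].
pose os (H : set G) := additive_subgroup H /\ nbhs 0 H.
have step n (p : G * set G) : exists q : G * set G, os p.2 ->
    [/\ os q.2, p.2 (q.1 - p.1), q.2 `<=` p.2 `&` V n &
        forall z, q.2 (z - q.1) -> ~ B n z].
  case: p => x H; have [[sH H0]|?] := pselect (os H); last by exists (x, H).
  (* The closure of B n has no interior, so it does not contain the coset. *)
  have [y [Hyx nBy]] : exists y, H (y - x) /\ ~ closure (B n) y.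
    apply: contrapT => /forallNP nxy.
    have : (closure (B n))^° x.
      apply: filterS (nbhs_translate x H0) => y Hyx.
      by apply: contrapT => nBy; apply: (nxy y).
    by rewrite Bint.
  have [W yW WB] : exists2 W, nbhs y W & W `&` B n = set0.
    apply: contrapT => nW; apply: nBy => W yW.
    rewrite setIC; apply/set0P/eqP => WB.
    by apply: nW; exists W.
  have [H' [sH' H'0 H'sub]] := gconvex_open_subgroup cvx
    (filterI (filterI H0 (V0 n)) (nbhs_translate0 yW)).
  exists (y, H') => _; split=> //=.
    by move=> z /H'sub[].
  move=> z /H'sub[_ /=]; rewrite addrC subrK => Wz Bz.
  by have : (W `&` B n) z by []; rewrite WB.
have [nxt nxtP] := choice (fun np : nat * (G * set G) => step np.1 np.2).
pose p := nat_rect (fun=> (G * set G)%type) (0, setT) (fun n q => nxt (n, q)).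
have os_p n : os (p n).2.
  elim: n => [|n IH]; first by split; [split|exact: filterT].
  by have [] := nxtP (n, p n) IH.
pose x n := (p n).1; pose H n := (p n).2.
have pS n : [/\ os (H n.+1), H n (x n.+1 - x n), H n.+1 `<=` H n `&` V n &
    forall z, H n.+1 (z - x n.+1) -> ~ B n z] := nxtP (n, p n) (os_p n).
have H_le n i : H (n + i)%N `<=` H n.
  elim: i => [|i IH]; first by rewrite addn0.
  by rewrite addnS => y Hy; apply: IH; have [_ _ /(_ _ Hy)[]] := pS (n + i)%N.
have x_tail n k : (n <= k)%N -> H n (x k - x n).
  move=> /subnKC <-; elim: (k - n)%N => [|i IH].
    by rewrite addn0 subrr; exact: (os_p n).1.1.
  rewrite addnS -[x _ - _](subrKA (x (n + i)%N)).
  apply: additive_subgroupD => //; first exact: (os_p n).1.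
  by have [_ + _ _] := pS (n + i)%N; exact: H_le.
have [l xl] : exists l : G, x @ \oo --> l.
  apply: (cpl (x @ \oo) _) => A A0.
  have [n _ /(_ n (leqnn n)) VnA] := Vbase A A0.
  exists ([set y | H n.+1 (y - x n.+1)], [set y | H n.+1 (y - x n.+1)]).
    by split; exists n.+1 => // k /= /x_tail.
  move=> [y z] [/= Hy Hz]; apply: VnA.
  have [_ _ HV _] := pS n; apply: (HV _ _).2.
  rewrite -[y](subrK (x n.+1)) -addrA -[x _ - z]opprB.
  by apply: (os_p n.+1).1.2.
have [n _ Bl] := Bcover l I.
have [[sH H0] _ _ /(_ l)] := pS n; apply => //.
apply: (open_subgroup_closed (u := fun k => x k - x n.+1) sH H0).
  by exists n.+1 => // k /= /x_tail.
exact: (cvgB_group (g := fun=> x n.+1) _ xl (cvg_cst _)).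
Qed.

End LocallyConvex.

(** * Series expansions in the closures of neighborhoods of 0 *)

(** Successive approximation: if the error [r k] lies in the closure of [A k],
    some [d k] in [A k] is so close to it that the next error [r k - d k] lies
    in the closure of [A k.+1], a neighborhood of 0, and in the [k]-th member
    [V k] of a countable base, which forces the errors to tend to 0. *)
Lemma closure_series_expansion {R : realType} {G : topologicalZmodType}
    (A : nat -> set G) (m : nat) (x : G) :
  metrizable R G -> (forall k, nbhs 0 (closure (A k))) ->
  closure (A m) x ->
  exists d : nat -> G, [/\ forall k, (k < m)%N -> d k = 0,
    forall k, (m <= k)%N -> A k (d k) & series d @ \oo --> x].
Proof.
move=> /(metrizable_nbhs_base 0)[V [V0 Vbase]] A0 Ax.
have step (kr : nat * G) : exists d, closure (A kr.1) kr.2 ->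
    [/\ A kr.1 d, closure (A kr.1.+1) (kr.2 - d) & V kr.1 (kr.2 - d)].
  case: kr => k r; have [Ar|?] := pselect (closure (A k) r); last by exists 0.
  have [d [Ad [? ?]]] := Ar _ (nbhs_reflect r (filterI (A0 k.+1) (V0 k))).
  by exists d.
have [c cP] := choice step.
pose d_at k r := if (k < m)%N then 0 else c (k, r).
pose r := nat_rect (fun=> G) x (fun k s => s - d_at k s).
have r_le k : (k <= m)%N -> r k = x.
  elim: k => // k IH km; rewrite /= IH ?(ltnW km)//.
  by rewrite /d_at km subr0.
have rP k : (m <= k)%N -> closure (A k) (r k).
  elim: k => [|k IH]; first by rewrite leqn0 => /eqP m0; rewrite -m0 r_le.
  rewrite leq_eqVlt => /predU1P[<-|mk]; first by rewrite r_le.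
  by have [_ + _] := cP (k, r k) (IH mk); rewrite /= /d_at ltnNge -ltnS mk.
exists (fun k => d_at k (r k)); split=> [k km|k mk|].
- by rewrite /d_at km.
- by have [+ _ _] := cP (k, r k) (rP k mk); rewrite /d_at ltnNge mk.
have seriesE n : series (fun k => d_at k (r k)) n = x - r n.
  rewrite /series /=; elim: n => [|n IH]; first by rewrite big_geq ?subrr.
  by rewrite big_nat_recr//= IH opprD opprK addrA.
have r0 : r @ \oo --> (0 : G).
  move=> B /Vbase[N _ VB]; exists (maxn N m).+1 => // -[//|k] /=.
  rewrite ltnS geq_max => /andP[Nk mk]; apply: (VB k Nk).
  by have [_ _ +] := cP (k, r k) (rP k mk); rewrite /d_at ltnNge mk.
rewrite (funext seriesE) -[X in _ --> X]subr0.
exact: (cvgB_group (f := fun=> x) _ (cvg_cst x) r0).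
Qed.

(** * Scaling by the generalized numbers [gpow b] *)

Section GpowScaling.
Context {R : realType}.

Lemma gpowN_mul (b : R) : gpow (- b) * gpow b = 1.
Proof.
rewrite /gpow /gclass -rmorphM.
rewrite -[RHS](rmorph1 (\pi_{ideal_quot negligible_ideal R})%qT).
congr (\pi_ _)%qT; apply: val_inj; apply/funext => e /=.
have /andP[e0 _] := eps_valP e.
have -> : (1 : net R) e = ((e : R) `^ (- b) * (e : R) `^ b)%:C%C.
  by rewrite -powRD ?addNr ?powRr0//; apply/implyP => _; rewrite gt_eqF.
by rewrite rmorphM.
Qed.

Lemma gabs1_le1 : gabs (1 : gen_num R) <= 1.
Proof.
rewrite -lee_fin gabsE -expeR0 lee_expeR leeNl oppe0.
rewrite -[1](rmorph1 (\pi_{ideal_quot negligible_ideal R})%qT).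
by rewrite gvaluation_class; apply: net_valuation_ge; exact: bigO_pow1.
Qed.

Lemma gscale_continuousr {G : topologicalGModType R} (a : gen_num R) :
  continuous ( *:%R a : G -> G).
Proof.
move=> x.
exact: (cvg_comp2 (h := fun (b : gen_num R) (y : G) => b *: y)
  (cvg_cst a) cvg_id (@gmod_scale_continuous R G (a, x))).
Qed.

(** As [gpow b] is invertible, scaling by it is a homeomorphism. *)
Lemma nbhs0_closure_gpow {G : topologicalGModType R} (b : R) (D : set G) :
  nbhs 0 (closure D) -> nbhs 0 (closure ( *:%R (gpow b) @` D)).
Proof.
move=> D0; have : nbhs 0 [set x : G | closure D (gpow (- b) *: x)].
  have := @gscale_continuousr G (gpow (- b)) 0.
  by rewrite /continuous_at scaler0 => /(_ _ D0).
apply: filterS => x /= Dx W xW.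
have /Dx[y [Dy Wy]] : nbhs (gpow (- b) *: x) [set y | W (gpow b *: y)].
  have := @gscale_continuousr G (gpow b) (gpow (- b) *: x).
  rewrite /continuous_at scalerA mulrC gpowN_mul scale1r.
  by move=> /(_ _ xW).
by exists (gpow b *: y); split => //; exists y.
Qed.

(** The scalars 0 and -1 have absolute value at most 1, so a balanced set is
    stable under them. *)
Lemma absolutely_gconvex_subgroup {M : lmodType (gen_num R)} (A : set M) :
  absolutely_gconvex A -> A !=set0 -> additive_subgroup A.
Proof.
move=> [bA [AD _]] [a Aa]; split=> [|x y Ax Ay].
  by rewrite -(scale0r a); apply: bA => //; rewrite gabs0.
apply: AD => //; rewrite -scaleN1r; apply: bA => //; rewrite gabsN.
exact: gabs1_le1.
Qed.

End GpowScaling.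

(** * Webs *)

(** Besides the convergence that defines type C, the exponents [rho] shrink the
    sets of the branch into any neighborhood [U] of 0. Choose [x k] in the
    [k]-th set with [gpow (rho k) *: x k] outside [U] whenever this is possible.
    The terms of the resulting convergent series are eventually in [U], so
    eventually no such choice was possible. *)
Lemma web_typeC_small {R : realType} {F : topologicalGModType R}
    (C : seq nat -> set F) (n : nat -> nat) :
  web_typeC C -> (forall k, (0 < k)%N -> (0 < n k)%N) ->
  (forall k, (0 < k)%N -> C [seq n i | i <- iota 1 k] 0) ->
  exists rho : nat -> R,
    (forall U, nbhs 0 U -> \forall k \near \oo,
      forall x, C [seq n i | i <- iota 1 k] x -> U (gpow (rho k) *: x)) /\
    forall x : nat -> F,
    (forall k, (0 < k)%N -> C [seq n i | i <- iota 1 k] (x k)) ->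
    exists l : F,
      (fun m => \sum_(1 <= k < m.+1) gpow (rho k) *: x k) @ \oo --> l.
Proof.
move=> typeC n_gt0 C0; have [rho rhoP] := typeC n n_gt0.
have cvx x := rhoP rho x (fun k _ => lexx (rho k)).
exists rho; split=> // U U0.
pose Ck k := C [seq n i | i <- iota 1 k].
have bad k : exists x, (0 < k)%N -> Ck k x /\
    (U (gpow (rho k) *: x) -> forall y, Ck k y -> U (gpow (rho k) *: y)).
  (* The default 0 keeps x k in the k-th set when that set has no bad point. *)
  have [[y [Cy Uy]]|nbad] :=
    pselect (exists y, Ck k y /\ ~ U (gpow (rho k) *: y)).
    by exists y.
  exists 0 => k0; split=> [|_ y Cy]; first exact: C0.
  by apply: contrapT => Uy; apply: nbad; exists y.
have [x xP] := choice bad.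
have [l xl] := cvx x (fun k k0 => (xP k k0).1).
have := cvgB_group _ (cvg_comp _ _ (@cvg_addnr 1) xl) xl; rewrite subrr.
move=> /(_ _ _ U0) [N _ HN].
exists N.+1 => // -[//|k] /= Nk y Cy; apply: (xP _ _).2 => //.
have /(_ Nk) := HN k; rewrite /= addn1.
by rewrite big_nat_recr//= addrAC subrr add0r.
Qed.

(** A set of the web is the countable union of its successors, and a countable
    union of meager sets is meager; so a set with nonmeager preimage always has
    a successor with nonmeager preimage. *)
Lemma nonmeager_web_branch {G : topologicalType} {M : Type}
    (C : seq nat -> set M) (T : G -> M) :
  web C -> ~ meager [set: G] -> exists n : nat -> nat,
  (forall k, (0 < k)%N -> (0 < n k)%N) /\
  forall k, (0 < k)%N -> ~ meager (T @^-1` C [seq n i | i <- iota 1 k]).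
Proof.
move=> [C1 CS] nmG.
(* The empty index stands for the whole space, as the root of the web. *)
pose D s := if s is [::] then [set: G] else T @^-1` C s.
have DS s : all (fun n => 0 < n)%N s -> D s `<=` \bigcup_n D (rcons s n.+1).
  move=> s0 x Dx.
  have : (\bigcup_(n in [set n | (0 < n)%N]) C (rcons s n)) (T x).
    case: s s0 Dx => [|a s] s0 Dx; first by rewrite -C1.
    by rewrite -CS.
  by move=> [[//|n] _ Cx]; exists n => //; case: (s) Cx.
have step s : exists n, all (fun n => 0 < n)%N s -> ~ meager (D s) ->
    ~ meager (D (rcons s n.+1)).
  apply: contrapT => /forallNP H.
  have [s0 nmD] : all (fun n => 0 < n)%N s /\ ~ meager (D s).
    by split; apply: contrapT => ns; apply: (H 0%N) => // /ns.
  apply: nmD.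
  have [B [Bint BD]] : meager (\bigcup_n D (rcons s n.+1)).
    apply: meager_bigcup => n; apply: contrapT => nm.
    by apply: (H n).
  by exists B; split=> //; exact: subset_trans (DS s s0) BD.
have [h hP] := choice step.
pose s := nat_rect (fun=> seq nat) [::] (fun _ s => rcons s (h s).+1).
have sP k : all (fun n => 0 < n)%N (s k) /\ ~ meager (D (s k)).
  elim: k => [|k [s0 nm]] //=; rewrite all_rcons s0; split=> //; exact: hP.
pose n k := (h (s k.-1)).+1.
have nE k : [seq n i | i <- iota 1 k] = s k.
  by elim: k => // k IH; rewrite -[X in iota 1 X](addn1 k) iotaD map_cat IH cats1.
exists n; split=> // k k0; rewrite nE.
by have [_] := sP k; rewrite /D; case: k k0 => //= k _; case: (s k).
Qed.

(** * The closed graph theorem *)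

Theorem theorem1p4 (R : realType) (G F : topologicalGModType R)
    (hG : frechet G) (hF : locally_gconvex F)
    (hweb : exists C : seq nat -> set F,
       [/\ web C, absolutely_gconvex_web C & web_typeC C])
    (T : {linear G -> F})
    (hT : sequentially_closed (graph_set T)) :
  continuous T.
Proof.
have [C [webC absC typeC]] := hweb.
have [n [n_gt0 nmn]] := nonmeager_web_branch T webC (frechet_not_meager hG).
pose Ck k := C [seq n i | i <- iota 1 k]; pose D k := T @^-1` Ck k.
have sC k : (0 < k)%N -> additive_subgroup (Ck k).
  move=> k0; apply: absolutely_gconvex_subgroup.
    apply: absC; case: k k0 => // k _; apply/allP => _ /mapP[i + ->].
    by rewrite mem_iota => /andP[/n_gt0].
  have [x /interior_subset Dx] := not_meager_interior_closure (nmn k k0).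
  by have [y [Dy _]] := Dx _ filterT; exists (T y).
have sD k : (0 < k)%N -> additive_subgroup (D k).
  move=> /sC[C0 CB]; split=> [|x y]; first by rewrite /D /= raddf0.
  by rewrite /D /= raddfB; exact: CB.
have D0 k : (0 < k)%N -> nbhs 0 (closure (D k)).
  move=> k0; apply: closure_subgroup_nbhs0; first exact: sD.
  exact: not_meager_interior_closure (nmn k k0).
have [rho [small cvx]] := web_typeC_small typeC n_gt0 (fun k k0 => (sC k k0).1).
(* By linearity, continuity at 0 is enough. *)
suff T0 (U : set F) : nbhs 0 U -> nbhs 0 (T @^-1` U).
  move=> x U /nbhs_translate0/T0/(nbhs_translate x).
  by apply: filterS => y /=; rewrite raddfB addrC subrK.
move=> U0; have [H [sH H0 HU]] := gconvex_open_subgroup hF U0.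
have [N _ smallN] := small H H0.
(* The branch is indexed from 1 and series from 0, hence the shift in A. *)
pose A k := *:%R (gpow (rho k.+1)) @` D k.+1.
have A0 k : nbhs 0 (closure (A k)) by exact/nbhs0_closure_gpow/D0.
have [_ mG _] := hG.
apply: filterS (A0 N) => x Ax; apply: HU.
have [d [d_lt d_ge dx]] := closure_series_expansion mG A0 Ax.
have dE k : exists y, [/\ D k.+1 y, d k = gpow (rho k.+1) *: y & H (T (d k))].
  have [Nk|/d_lt dk0] := leqP N k.
    have [y Dy <-] := d_ge k Nk; exists y; split=> //; rewrite linearZ.
    apply: (smallN k.+1) => //=.
    exact: leqW.
  exists 0; rewrite dk0 scaler0 raddf0; split=> //; last exact: sH.1.
  exact: (sD _ _).1.
have [y yP] := choice dE.
have yC k : (0 < k)%N -> Ck k (T (y k.-1)).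
  by case: k => // k _; have [] := yP k.
have [l Tl] := cvx _ yC.
have TdE j : T (series d j) = \sum_(1 <= k < j.+1) gpow (rho k) *: T (y k.-1).
  rewrite /series /= raddf_sum big_add1 /=; apply: eq_bigr => k _.
  by have [_ -> _] := yP k; rewrite linearZ.
have {}Tl : (fun j => T (series d j)) @ \oo --> l by rewrite (funext TdE).
have xl : l = T x.
  apply: (hT (fun j => (series d j, T (series d j))) (x, l)) => //.
  exact: cvg_pair.
rewrite /= -xl; apply: (open_subgroup_closed sH H0 _ Tl).
apply: nearW => j; rewrite /= raddf_sum; apply: additive_subgroup_sum => // k.
by have [] := yP k.
Qed.
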